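(* Let $(\alpha_1,\ldots,\alpha_n,\tau)$ be a nondegenerate compatible tuple on $V$, let $K=\ker(\tau)$ and $U=V\setminus K$, and assume that there exist $i,j\in\{1,\ldots,n\}$ such that $\alpha_i(U)\subseteq U$ and $\alpha_j(U)\subseteq U$. Then there exists $\lambda_{ij}\in\mathbb{K}\setminus\{0\}$ such that $\alpha_i=\lambda_{ij}\alpha_j$, where $\lambda_{ij}=\tau(\alpha_i(u))/\tau(\alpha_j(u))$ for any $u\in U$.
   Context: $\mathbb{K}$ is a field of characteristic $0$, $V$ is a vector space over $\mathbb{K}$, and $n$ is a positive integer. Let $\alpha_1,\ldots,\alpha_n:V\to V$ and $\tau:V\to\mathbb{K}$ be linear maps. The tuple $(\alpha_1,\ldots,\alpha_n,\tau)$ is called compatible on $V$ if $$\tau(\alpha_i(x))\,\tau(y)=\tau(x)\,\tau(\alpha_i(y))\quad\text{and}\quad \tau(\alpha_i(x))\,\alpha_j(y)=\tau(\alpha_j(y))\,\alpha_i(x)$$ for all $x,y\in V$ and all $i,j\in\{1,\ldots,n\}$. A compatible tuple is nondegenerate if $\ker(\tau)\neq V$ and $\ker(\tau)\neq\{0\}$. Here $V\setminus K$ denotes the set-theoretic complement. *)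

(* Defs.v *)
From HB Require Import structures.
From mathcomp Require Import all_boot all_order all_algebra.
From mathcomp Require Import boolp classical_sets.

Set Implicit Arguments.
Unset Strict Implicit.
Unset Printing Implicit Defensive.

Import GRing.Theory.
Local Open Scope ring_scope.
Local Open Scope classical_set_scope.

Section CompatibleTuple.
Variables (K : fieldType) (V : lmodType K).

Definition ker (tau : {scalar V}) : set V := [set x | tau x = 0].

Definition compatible (n : nat) (alpha : 'I_n -> {linear V -> V})
    (tau : {scalar V}) : Prop :=
  forall (x y : V) (i j : 'I_n),
    tau (alpha i x) * tau y = tau x * tau (alpha i y) /\
    tau (alpha i x) *: alpha j y = tau (alpha j y) *: alpha i x.

Definition nondegenerate_compatible (n : nat)
    (alpha : 'I_n -> {linear V -> V}) (tau : {scalar V}) : Prop :=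
  [/\ compatible alpha tau, ker tau <> setT & ker tau <> [set 0]].

End CompatibleTuple.

(* Main.v *)
Require Import Defs.
From HB Require Import structures.
From mathcomp Require Import all_boot all_order all_algebra.
From mathcomp Require Import boolp classical_sets.

(** Compatibility forces every [alpha k] that moves some vector [u] to a vector
    with [tau (alpha k u) != 0] to have rank one, with the same kernel as [tau]:
    it is determined by its value at [u] through [tau]
    ([compatible_rank_one]).  Both [alpha i] and [alpha j] are of this kind for
    any [u] outside the kernel, so they are proportional as soon as their
    values at that single [u] are; this is the second compatibility equation at
    [(u, u)].  Applying [tau] to the resulting identity at any other vector
    outside the kernel shows that the ratio does not depend on [u]. *)

Set Implicit Arguments.
Unset Strict Implicit.
Unset Printing Implicit Defensive.

Import GRing.Theory.
Local Open Scope ring_scope.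
Local Open Scope classical_set_scope.

(** The second compatibility equation for the pair [(k, k)] makes [alpha k x]
    the multiple of [alpha k u] with coefficient
    [tau (alpha k x) / tau (alpha k u)], and the first one says that this
    coefficient is [tau x / tau u]. *)
Lemma compatible_rank_one (K : fieldType) (V : lmodType K) (n : nat)
    (alpha : 'I_n -> {linear V -> V}) (tau : {scalar V}) (k : 'I_n) (u x : V) :
    compatible alpha tau -> tau u != 0 -> tau (alpha k u) != 0 ->
  alpha k x = (tau x / tau u) *: alpha k u.
Proof.
move=> comp tu0 tku0.
have [tau_swap _] := comp x u k k; have [_ prop] := comp u x k k.
apply: (scalerI tku0); rewrite prop scalerA; congr (_ *: _).
by rewrite mulrA [_ * tau x]mulrC -tau_swap mulfK.
Qed.

Theorem proposition4p4 (K : fieldType) (charK0 : [pchar K] =i pred0)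
    (V : lmodType K) (n : nat) (n_gt0 : (0 < n)%N)
    (alpha : 'I_n -> {linear V -> V}) (tau : {scalar V})
    (ndeg : nondegenerate_compatible alpha tau)
    (i j : 'I_n)
    (alpha_iU : alpha i @` (~` ker tau) `<=` ~` ker tau)
    (alpha_jU : alpha j @` (~` ker tau) `<=` ~` ker tau) :
  exists lambda : K,
    [/\ lambda != 0,
        forall x : V, alpha i x = lambda *: alpha j x
      & forall u : V, (~` ker tau) u ->
          lambda = tau (alpha i u) / tau (alpha j u)].
Proof.
have [comp ker_neqT _] := ndeg.
have nzU k : alpha k @` (~` ker tau) `<=` ~` ker tau ->
    forall u, tau u != 0 -> tau (alpha k u) != 0.
  move=> alpha_kU u /eqP tu0; apply/eqP.
  by apply: alpha_kU; exists u.
have [u tu0] : exists u, tau u != 0.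
  apply: contra_notP ker_neqT => /forallNP tau0.
  by apply/seteqP; split=> // x _; apply/eqP/negPn/negP/tau0.
have tiu0 := nzU i alpha_iU u tu0; have tju0 := nzU j alpha_jU u tu0.
pose lambda := tau (alpha i u) / tau (alpha j u).
have prop_u : alpha i u = lambda *: alpha j u.
  have [_ prop] := comp u u i j; apply: (scalerI tju0).
  by rewrite -prop scalerA mulrC divfK.
have prop x : alpha i x = lambda *: alpha j x.
  rewrite (compatible_rank_one x comp tu0 tiu0).
  rewrite (compatible_rank_one x comp tu0 tju0).
  by rewrite prop_u !scalerA mulrC.
exists lambda; split=> // [|v /eqP tv0]; first by rewrite mulf_neq0 ?invr_eq0.
by rewrite prop linearZ /= mulfK // nzU.
Qed.
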